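(* For every integer $\Delta\ge 4$ and every odd integer $d\ge 1$, there exists a graph with maximum degree at most $\Delta$ containing a distance-$d$ half graph of order $\left\lfloor \frac{\Delta}{2}\right\rfloor^{\left\lceil \frac{d}{2}\right\rceil}$.
   Context: All graphs are finite, undirected and simple; $\mathrm{dist}$ is the shortest-path distance. For integers $d,\ell\ge1$, $2\ell$ pairwise distinct vertices $a_1,\dots,a_\ell,b_1,\dots,b_\ell$ of a graph form a distance-$d$ half graph of order $\ell$ if for all $i,j\in[1,\ell]$ we have $\mathrm{dist}(b_i,a_j)\le d$ if and only if $i<j$. *)

(* Defs.v *)
From mathcomp Require Import all_boot.

Set Implicit Arguments.
Unset Strict Implicit.
Unset Printing Implicit Defensive.

Record sgraph := SGraph {
  vertex :> finType;
  adj : rel vertex;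
  adj_sym : symmetric adj;
  adj_irrefl : irreflexive adj
}.

Definition degree (G : sgraph) (x : G) : nat := #|[set y : G | adj x y]|.

Definition max_degree (G : sgraph) : nat := \max_(x : G) degree x.

(* The tuple p lists the vertices after x, so its size is the number of edges. *)
Definition has_path (G : sgraph) (x y : G) (k : nat) : bool :=
  [exists p : k.-tuple G,
     [&& path (@adj G) x p, last x p == y & uniq (x :: p)]].

(* None stands for an infinite distance. A path has distinct vertices, hence
   length less than #|G|, so searching the lengths below #|G| in increasing
   order loses nothing. *)
Definition dist (G : sgraph) (x y : G) : option nat :=
  ohead [seq k <- iota 0 #|G| | has_path x y k].

Definition dist_le (G : sgraph) (x y : G) (d : nat) : bool :=
  if dist x y is Some k then k <= d else false.

(* The indices run over 0, ..., l - 1 instead of 1, ..., l; only their order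
   matters. *)
Definition half_graph (G : sgraph) (d l : nat) (a b : 'I_l -> G) : Prop :=
  [/\ injective a, injective b, (forall i j, a i <> b j)
    & forall i j, dist_le (b i) (a j) d <-> i < j].

Definition contains_half_graph (G : sgraph) (d l : nat) : Prop :=
  exists a b : 'I_l -> G, half_graph d a b.

(* Main.v *)
(** Put [k = Delta./2] and [d = 2 n + 1]. Write the indices as words of length
    [n + 1] over [k] letters, so that [i %/ k ^ m] is the prefix of [i] without
    its last [m] letters. Then [i < j] iff for some [m <= n] the prefixes
    [i %/ k ^ m < j %/ k ^ m] differ in their last letter only.

    On either side, a vertex [(s, m, p)] has a height [s <= n] and carries a
    prefix [p] with [m] letters removed. A leaf [(0, 0, i)] climbs to height [n]
    by removing one letter per step and, from some [m] on, keeping the prefix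
    unchanged. At height [n] the two sides are joined by the half graphs on
    siblings [p < q]. If the layer of a vertex is its height [s] on the side of
    the [b]'s and [2 n + 1 - s] on the side of the [a]'s, all edges join
    consecutive layers, so a walk of length at most [d] from [b_i] to [a_j] can
    only climb, cross once and descend; this is possible exactly when [i < j].
    A vertex has at most [k] neighbours below it and at most [k] others. *)

Require Import Defs.
From mathcomp Require Import all_boot.
From mathcomp Require Import zify.

Set Implicit Arguments.
Unset Strict Implicit.
Unset Printing Implicit Defensive.

Lemma dist_leP (G : sgraph) (x y : G) d :
  reflect (exists p, [/\ path (@adj G) x p, last x p = y & size p <= d])
          (dist_le x y d).
Proof.
rewrite /dist_le /dist; apply: (iffP idP).
  case E: [seq k <- _ | _] => [|k s] //= le_kd.
  have: k \in [seq k <- iota 0 #|G| | has_path x y k] by rewrite E mem_head.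
  rewrite mem_filter => /andP[/existsP[p /and3P[xp /eqP yp _]] _].
  by exists p; rewrite size_tuple.
(* A walk shortens to one with distinct vertices, and the filtered [iota] is increasing, so its head
   is at most that length. *)
case=> p [xp <- le_pd]; case: (shortenP xp) => q xq uq /uniq_leq_size le_qp.
have{le_qp} le_qd : size q <= d.
  by apply: leq_trans le_pd; apply: le_qp; case/andP: uq.
have lt_qG : size q < #|G| by have := max_card (mem (x :: q)); rewrite (card_uniqP uq).
have: size q \in [seq k <- iota 0 #|G| | has_path x (last x q) k].
  rewrite mem_filter mem_iota lt_qG /= andbT.
  by apply/existsP; exists (in_tuple q); rewrite xq eqxx uq.
have: sorted ltn [seq k <- iota 0 #|G| | has_path x (last x q) k].
  by apply: sorted_filter (iota_ltn_sorted _ _); exact: ltn_trans.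
case: [seq k <- _ | _] => [|k s] //= /(order_path_min ltn_trans)/allP lt_ks.
by rewrite inE => /predU1P[<-//|/lt_ks /ltnW le_kq]; apply: leq_trans le_qd.
Qed.

Lemma dist_le_seq (G : sgraph) (f : nat -> G) d :
  (forall s, s < d -> adj (f s) (f s.+1)) -> dist_le (f 0) (f d) d.
Proof.
move=> f_adj; apply/dist_leP; elim: d f_adj => [|d IHd] f_adj.
  by exists [::].
have [s lt_sd|p [fp lp le_pd]] := IHd; first exact/f_adj/ltnW.
by exists (rcons p (f d.+1)); rewrite rcons_path last_rcons size_rcons fp lp f_adj.
Qed.

(** [m.+1] is the least number of final letters whose removal makes [i] and [j] agree; removing all
    [h] does. *)
Lemma ltn_common_prefix k h i j : i < j -> j < k ^ h ->
  exists m, [/\ m < h, i %/ k ^ m < j %/ k ^ m &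
                i %/ k ^ m.+1 = j %/ k ^ m.+1].
Proof.
move=> lt_ij lt_jk.
have exP : exists n, i %/ k ^ n == j %/ k ^ n.
  by exists h; rewrite !divn_small ?(ltn_trans lt_ij).
case: (ex_minnP exP) => [[|m]] /eqP eq_m min_m.
  by move: eq_m lt_ij; rewrite expn0 !divn1 => ->; rewrite ltnn.
exists m; split=> //; first by apply: min_m; rewrite !divn_small ?(ltn_trans lt_ij).
rewrite ltn_neqAle leq_div2r ?(ltnW lt_ij) // andbT.
by apply/negP => /min_m; rewrite ltnn.
Qed.

Section Construction.

Variables k n : nat.
Hypothesis k_gt1 : 1 < k.

(* A node is [(c, s, m, p)], where [c] is [true] on the side of the [a]'s. Tuples
   with [s < m] are junk that only pads the vertex set. *)
Definition node : finType := (bool * 'I_n.+1 * 'I_n.+1 * 'I_(k ^ n.+1))%type.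

(** The test [m == s] lets one pause freeze the prefix for the rest of the climb. *)
Definition climb (u v : node) : bool :=
  let: (c, s, m, p) := u in let: (c', s', m', p') := v in
  [&& c == c', s' == s.+1 :> nat &
    (m <= s) && (m' == m) && (p' == p) ||
    [&& m == s, m' == s' & p' == p %/ k :> nat]].

Definition cross (u v : node) : bool :=
  let: (c, s, m, p) := u in let: (c', s', m', p') := v in
  [&& ~~ c, c', s == n :> nat, s' == n :> nat, m == m',
      p %/ k == p' %/ k & p < p'].

Definition node_adj : rel node :=
  [rel u v | [|| climb u v, climb v u, cross u v | cross v u]].

Lemma node_adj_sym : symmetric node_adj.
Proof.
by move=> u v; rewrite /node_adj /= orbCA (orbC (cross u v)).
Qed.

Lemma node_adj_irrefl : irreflexive node_adj.
Proof.
by move=> [[[c s] m] p]; rewrite /node_adj /= !eqxx ltn_eqF //; case: c.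
Qed.

Definition node_graph : sgraph := SGraph node_adj_sym node_adj_irrefl.

Lemma node_eq (c c' : bool) (s s' m m' : 'I_n.+1) (p p' : 'I_(k ^ n.+1)) :
  c = c' -> s = s' :> nat -> m = m' :> nat -> p = p' :> nat ->
  (c, s, m, p) = (c', s', m', p') :> node.
Proof. by move=> -> /val_inj -> /val_inj -> /val_inj ->. Qed.

(** * Degree bound *)

Definition last_letter (u : node) : 'I_k :=
  Ordinal (ltn_pmod u.2 (ltnW k_gt1)).

Lemma card_last_letter (A : {set node}) :
  {in A &, injective last_letter} -> #|A| <= k.
Proof.
by move=> /card_in_imset <-; rewrite -[leqRHS]card_ord max_card.
Qed.

(** Keeping the prefix ends with [m < s], removing a letter with [m = s]. So the neighbours below
    [u] are a single vertex or siblings. *)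
Lemma card_climb_to (u : node) : #|[set v | climb v u]| <= k.
Proof.
apply: card_last_letter => v w; rewrite !inE.
case: u v w => [[[c s] m] p] [[[c1 s1] m1] p1] [[[c2 s2] m2] p2] /=.
move=> /and3P[/eqP c1E /eqP s1E v_u] /and3P[/eqP c2E /eqP s2E w_u] [] /= eq_mod.
move: v_u w_u; rewrite -!val_eqE /= => v_u w_u.
apply: node_eq; [by rewrite c1E c2E | lia | lia |].
rewrite [LHS](divn_eq _ k) [RHS](divn_eq _ k) eq_mod.
case/orP: v_u => [/andP[/andP[le1 /eqP m1E] /eqP p1E]|/and3P[m1E m1E' /eqP p1E]];
case/orP: w_u => [/andP[/andP[le2 /eqP m2E] /eqP p2E]|/and3P[m2E m2E' /eqP p2E]];
  lia.
Qed.

Lemma card_climb_cross (u : node) :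
  #|[set v | [|| climb u v, cross u v | cross v u]]| <= k.
Proof.
case: u => [[[c s] m] p]; have [sn|s_neq_n] := eqVneq (s : nat) n.
  apply: card_last_letter => v w; rewrite !inE.
  case: v w => [[[c1 s1] m1] p1] [[[c2 s2] m2] p2] /=.
  rewrite -!val_eqE /= => uv uw [] /= eq_mod.
  have [lt_s1 lt_s2] := (ltn_ord s1, ltn_ord s2).
  have [c12 s12 m12 eq_div] :
      [/\ c1 = c2, s1 = s2 :> nat, m1 = m2 :> nat & p1 %/ k = p2 %/ k].
    move: {eq_mod} uv uw; move: (p1 %/ k) (p2 %/ k) (p %/ k) => x y z.
    by case: c1 c2 c => [] [] [] //= uv uw; split; lia.
  apply: node_eq => //.
  by rewrite [LHS](divn_eq _ k) [RHS](divn_eq _ k) eq_mod eq_div.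
(* Below height [n] there are at most two neighbours above, told apart by whether [m] is kept. *)
apply: leq_trans k_gt1; rewrite -card_bool.
rewrite -(@card_in_imset _ _ (fun v : node => v.1.2 == m)) ?max_card //.
move=> v w; rewrite !inE.
case: v w => [[[c1 s1] m1] p1] [[[c2 s2] m2] p2] /=.
rewrite (negPf s_neq_n) /= !andbF !orbF -!val_eqE /=.
move=> /and3P[/eqP c1E /eqP s1E uv] /and3P[/eqP c2E /eqP s2E uw] eq_m.
have {}eq_m : (m1 == m :> nat) = (m2 == m :> nat) by exact: eq_m.
move: (p %/ k) uv uw => x uv uw.
by apply: node_eq; [rewrite -c1E -c2E | lia | lia | lia].
Qed.

Lemma max_degree_node_graph : max_degree node_graph <= k.*2.
Proof.
apply/bigmax_leqP => u _; rewrite /degree -addnn.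
apply: leq_trans (leq_add (card_climb_cross u) (card_climb_to u)).
apply: leq_trans (leq_card_setU _ _); apply/subset_leq_card/subsetP => v.
by rewrite !inE /= /node_adj /= => /or4P[] ->; rewrite ?orbT.
Qed.

(** * Layers and short walks *)

Definition leaf c (i : 'I_(k ^ n.+1)) : node := (c, ord0, ord0, i).

Definition layer (u : node) : nat :=
  let: (c, s, _, _) := u in if c then n.*2.+1 - s else s.

Lemma layer_adj (u v : node) : node_adj u v -> layer v <= (layer u).+1.
Proof.
case: u v => [[[c s] m] p] [[[c' s'] m'] p']; rewrite /node_adj /=.
have [lt_s lt_s'] := (ltn_ord s, ltn_ord s').
case/or4P.
- by case/and3P=> /eqP-> /eqP sE _; case: ifP; lia.
- by case/and3P=> /eqP-> /eqP sE _; case: ifP; lia.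
- by case/and5P=> /negPf-> -> /eqP sE /eqP s'E _; lia.
- by case/and5P=> /negPf-> -> /eqP sE /eqP s'E _; lia.
Qed.

Lemma layer_path (u : node) q :
  path node_adj u q -> layer (last u q) <= layer u + size q.
Proof.
elim: q u => [|v q IHq] u /=; first by rewrite addn0.
case/andP=> /layer_adj uv /IHq le_v.
by apply: leq_trans le_v _; rewrite addnS -addSn leq_add2r.
Qed.

(* Holds for all vertices on a walk from [leaf false i] that goes up one layer
   at each step. *)
Definition ascent (i : nat) (u : node) : bool :=
  let: (c, _, m, p) := u in
  if c then i %/ k ^ m < p else p == i %/ k ^ m :> nat.

(** On a descent [p = p' %/ k], and since division is monotone, a strict inequality of shorter
    prefixes passes to the longer ones. *)
Lemma ascent_step i (u v : node) :
  node_adj u v -> layer u < layer v -> ascent i u -> ascent i v.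
Proof.
case: u v => [[[c s] m] p] [[[c' s'] m'] p']; rewrite /node_adj /=.
have [lt_s lt_s'] := (ltn_ord s, ltn_ord s').
case/or4P.
- case/and3P=> /eqP<- /eqP s'E up; case: c => [|_ /eqP pE]; first lia.
  case/orP: up => [/andP[/andP[_ /eqP->] /eqP->]|]; first exact/eqP.
  by case/and3P=> /eqP mE /eqP-> /eqP->; rewrite pE s'E mE expnSr divnMA.
- case/and3P=> /eqP<- /eqP sE down; case: c' => [_ lt_ip|]; last lia.
  case/orP: down lt_ip => [/andP[/andP[_ /eqP->] /eqP->//]|].
  case/and3P=> /eqP mE /eqP-> /eqP->; rewrite sE mE expnSr divnMA.
  by apply: contraTT; rewrite -!leqNgt; apply: leq_div2r.
- by case/and5P=> /negPf-> -> _ _ /and3P[/eqP<- _ lt_pp'] _ /eqP<-.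
- by case/and5P=> /negPf-> -> /eqP-> /eqP-> _; lia.
Qed.

(** The target lies in layer [n.*2.+1] and an edge gains at most one layer, so the length bound
    forces every edge up. *)
Lemma ascent_path i j (u : node) q :
  path node_adj u q -> last u q = leaf true j ->
  layer u + size q <= n.*2.+1 -> ascent i u -> i < j.
Proof.
elim: q u => [|v q IHq] u; first by move=> _ /= -> _ /=; rewrite divn1.
move=> /andP[uv vq] lq le_u up_u.
have {}le_u : layer u + (size q).+1 <= n.*2.+1 := le_u.
have le_v : n.*2.+1 <= layer v + size q.
  by have := layer_path vq; rewrite [last _ _]lq /= subn0.
have le_vu := layer_adj uv.
by apply: (IHq v) => //; [lia | apply: (ascent_step uv) => //; lia].
Qed.

(** * Walks realising the distance *)

Definition climber c (i : 'I_(k ^ n.+1)) m s : node :=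
  (c, inord s, inord (minn s m),
   Ordinal (leq_ltn_trans (leq_div i (k ^ minn s m)) (ltn_ord i))).

Lemma climber0 c i m : climber c i m 0 = leaf c i.
Proof.
by apply: node_eq => //=; rewrite ?inordK // min0n // divn1.
Qed.

Lemma climb_climber c i m s : m <= n -> s < n ->
  climb (climber c i m s) (climber c i m s.+1).
Proof.
move=> le_mn lt_sn; rewrite /climber /= -!val_eqE /= !inordK; try lia.
rewrite eqxx; have [le_ms|lt_sm] := leqP m s.
  by rewrite !(minn_idPr _) ?(leqW le_ms) ?eqxx ?le_ms //.
by rewrite !(minn_idPl _) ?(ltnW lt_sm) // (expnSr k s) divnMA !eqxx orbT.
Qed.

Lemma cross_climber (i j : 'I_(k ^ n.+1)) m : m <= n ->
  i %/ k ^ m < j %/ k ^ m -> i %/ k ^ m.+1 = j %/ k ^ m.+1 ->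
  cross (climber false i m n) (climber true j m n).
Proof.
move=> le_mn lt_ij eq_ij; rewrite /climber /= inordK // (minn_idPr le_mn).
by rewrite -!divnMA -(expnSr k m) eq_ij lt_ij !eqxx.
Qed.

Lemma dist_le_leaf (i j : 'I_(k ^ n.+1)) :
  @dist_le node_graph (leaf false i) (leaf true j) n.*2.+1 <-> i < j.
Proof.
split=> [/dist_leP[q [iq lq le_q]] | lt_ij].
  by apply: (ascent_path iq lq) => //=; rewrite divn1.
have [m [le_mn lt_m eq_m]] := ltn_common_prefix lt_ij (ltn_ord j).
(* The first [n] edges climb from [leaf false i], the next one crosses, and the last [n] run the
   climb from [leaf true j] backwards. *)
pose f s : node_graph :=
  if s <= n then climber false i m s else climber true j m (n.*2.+1 - s).
have f0 : f 0 = leaf false i by rewrite /f climber0.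
have fd : f n.*2.+1 = leaf true j.
  by rewrite /f leqNgt ltnS -addnn leq_addr /= subnn climber0.
rewrite -f0 -fd; apply: dist_le_seq => s lt_s.
rewrite /f; case: (ltngtP s n) => [lt_sn|lt_ns|->].
- by apply/or4P/Or41/climb_climber.
- have -> : n.*2.+1 - s = (n.*2.+1 - s.+1).+1 by lia.
  by apply/or4P/Or42/climb_climber; lia.
- have -> : n.*2.+1 - n.+1 = n by lia.
  by apply/or4P/Or43/cross_climber.
Qed.

Lemma contains_half_graph_node_graph :
  contains_half_graph node_graph n.*2.+1 (k ^ n.+1).
Proof.
exists (leaf true), (leaf false); split=> [i j []|i j []|//|i j] //.
exact: dist_le_leaf.
Qed.

End Construction.

Theorem theorem3p1 (Delta d : nat) (hDelta : 4 <= Delta) (hd : 1 <= d)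
    (hodd : odd d) :
  exists G : sgraph,
    max_degree G <= Delta /\ contains_half_graph G d (Delta./2 ^ uphalf d).
Proof.
have k_gt1 : 1 < Delta./2 by rewrite (half_leq hDelta).
exists (node_graph Delta./2 d./2); split.
  by apply: leq_trans (max_degree_node_graph _ k_gt1) _; lia.
have dE : d./2.*2.+1 = d by rewrite -[RHS]odd_double_half hodd.
have uE : d./2.+1 = uphalf d by rewrite uphalf_half hodd.
by have := contains_half_graph_node_graph d./2 k_gt1; rewrite dE uE.
Qed.
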